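(* Let $\mathcal{H}$ be a right quaternionic Hilbert space and let $T\in\mathcal{B}(\mathcal{H})$ be a bounded right $\mathbb{H}$-linear operator. Then $$\sigma_p(T)=\sigma_{S,p}(T),\qquad \sigma_r(T)=\sigma_{S,r}(T)\qquad\text{and}\qquad \sigma_c(T)=\sigma_{S,c}(T).$$
   Context: $\mathbb{H}$ denotes the division ring of real quaternions. For $q=a_0+a_1i+a_2j+a_3k\in\mathbb{H}$, $\mathrm{Re}(q)=a_0$, $\mathrm{Im}(q)=a_1i+a_2j+a_3k$, $q^*=\mathrm{Re}(q)-\mathrm{Im}(q)$, and $|q|=\sqrt{qq^*}$. A right quaternionic Hilbert space $\mathcal{H}$ is a right $\mathbb{H}$-module with an ($\mathbb{H}$-valued) inner product $\langle\cdot,\cdot\rangle$ (conjugate-symmetric, positive definite, right $\mathbb{H}$-linear in one argument in the usual sense), complete with respect to the norm $\|x\|=\sqrt{\langle x,x\rangle}$. A map $T:\mathcal{H}\to\mathcal{H}$ is right $\mathbb{H}$-linear if $T(u\alpha+v\beta)=T(u)\alpha+T(v)\beta$ for all $u,v\in\mathcal{H}$, $\alpha,\beta\in\mathbb{H}$; it is bounded if there is $K\ge 0$ with $\|Tx\|\le K\|x\|$ for all $x\in\mathcal{H}$. $\mathcal{B}(\mathcal{H})$ is the set of bounded right $\mathbb{H}$-linear operators on $\mathcal{H}$. An $\mathbb{R}$-linear operator $A$ on $\mathcal{H}$ is bounded below if there is $k>0$ with $\|Ax\|\ge k\|x\|$ for all $x\in\mathcal{H}$. $\mathrm{Ran}(A)$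 is the range of $A$ and the overline denotes norm closure. For $T\in\mathcal{B}(\mathcal{H})$ and $\lambda\in\mathbb{H}$: - $T_\lambda:\mathcal{H}\to\mathcal{H}$ is the bounded $\mathbb{R}$-linear (in general not right $\mathbb{H}$-linear) operator $T_\lambda(x)=x\lambda-Tx$. - $\Delta_\lambda(T)=T^2-2\,\mathrm{Re}(\lambda)T+|\lambda|^2I\in\mathcal{B}(\mathcal{H})$. The parts of the right spectrum are $$\sigma_p(T)=\{\lambda\in\mathbb{H}: T_\lambda(x)=0\text{ for some }x\in\mathcal{H}\setminus\{0\}\},$$ $$\sigma_r(T)=\{\lambda\in\mathbb{H}\setminus\sigma_p(T): \overline{\mathrm{Ran}(T_\lambda)}\ne\mathcal{H}\},$$ $$\sigma_c(T)=\{\lambda\in\mathbb{H}\setminus(\sigma_r(T)\cup\sigma_p(T)): T_\lambda\text{ is not bounded below}\}.$$ The parts of the $S$-spectrum are $$\sigma_{S,p}(T)=\{\lambda\in\mathbb{H}: \Delta_\lambda(T)(x)=0\text{ for some }x\in\mathcal{H}\setminus\{0\}\},$$ $$\sigma_{S,r}(T)=\{\lambda\in\mathbb{H}\setminus\sigma_{S,p}(T): \overline{\mathrm{Ran}(\Delta_\lambda(T))}\ne\mathcal{H}\},$$ $$\sigma_{S,c}(T)=\{\lambda\in\mathbb{H}\setminus(\sigma_{S,p}(T)\cup\sigma_{S,r}(T)): \Delta_\lambda(T)\text{ is not bounded below}\}.$$ *)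

(* Defs.v *)
From HB Require Import structures.
From mathcomp Require Import all_boot all_order all_algebra.
From mathcomp Require Import ring lra.
From mathcomp Require Import all_classical all_reals all_analysis.

Set Implicit Arguments.
Unset Strict Implicit.
Unset Printing Implicit Defensive.

Import Order.TTheory GRing.Theory Num.Theory.
Import numFieldNormedType.Exports.

Local Open Scope classical_set_scope.
Local Open Scope ring_scope.

(* [Quat a0 a1 a2 a3] is a0 + a1 i + a2 j + a3 k. *)
Record quat (R : Type) := Quat { qre : R; qi : R; qj : R; qk : R }.

Section QuatChoice.
Variable R : choiceType.

Definition tuple_of_quat (q : quat R) : R * R * R * R :=
  (qre q, qi q, qj q, qk q).
Definition quat_of_tuple (t : R * R * R * R) : quat R :=
  let: (a, b, c, d) := t in Quat a b c d.

Lemma tuple_of_quatK : cancel tuple_of_quat quat_of_tuple.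
Proof. by case. Qed.

HB.instance Definition _ := Choice.copy (quat R) (can_type tuple_of_quatK).

End QuatChoice.

Section QuatRing.
Variable R : realType.
Implicit Types p q : quat R.

Definition qadd p q :=
  Quat (qre p + qre q) (qi p + qi q) (qj p + qj q) (qk p + qk q).
Definition qopp q := Quat (- qre q) (- qi q) (- qj q) (- qk q).
(* Hamilton product: i^2 = j^2 = k^2 = ijk = -1. *)
Definition qmul p q :=
  Quat (qre p * qre q - qi p * qi q - qj p * qj q - qk p * qk q)
       (qre p * qi q + qi p * qre q + qj p * qk q - qk p * qj q)
       (qre p * qj q - qi p * qk q + qj p * qre q + qk p * qi q)
       (qre p * qk q + qi p * qj q - qj p * qi q + qk p * qre q).
Definition qreal (a : R) := Quat a 0 0 0.

Lemma qaddA : associative qadd.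
Proof. by move=> p q r; congr Quat; rewrite /= addrA. Qed.
Lemma qaddC : commutative qadd.
Proof. by move=> p q; congr Quat; rewrite addrC. Qed.
Lemma qadd0 : left_id (qreal 0) qadd.
Proof. by case=> a b c d; congr Quat; rewrite /= add0r. Qed.
Lemma qaddN : left_inverse (qreal 0) qopp qadd.
Proof. by case=> a b c d; congr Quat; rewrite /= addNr. Qed.

HB.instance Definition _ :=
  GRing.isZmodule.Build (quat R) qaddA qaddC qadd0 qaddN.

Lemma qmulA : associative qmul.
Proof. by move=> p q r; congr Quat; rewrite /=; ring. Qed.
Lemma qmul1q : left_id (qreal 1) qmul.
Proof. by case=> a b c d; congr Quat; rewrite /=; ring. Qed.
Lemma qmulq1 : right_id (qreal 1) qmul.
Proof. by case=> a b c d; congr Quat; rewrite /=; ring. Qed.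
Lemma qmulDl : left_distributive qmul +%R.
Proof. by move=> p q r; congr Quat; rewrite /=; ring. Qed.
Lemma qmulDr : right_distributive qmul +%R.
Proof. by move=> p q r; congr Quat; rewrite /=; ring. Qed.
Lemma qone_neq0 : qreal 1 != 0.
Proof. by apply/eqP => -[] /eqP; rewrite oner_eq0. Qed.

HB.instance Definition _ := GRing.Zmodule_isNzRing.Build (quat R)
  qmulA qmul1q qmulq1 qmulDl qmulDr qone_neq0.

Definition qim q := Quat 0 (qi q) (qj q) (qk q).
Definition qconj q := qreal (qre q) - qim q.
(* q * qconj q is real, so taking its real part loses nothing:
   see [qmul_conj]. *)
Definition qabs q : R := Num.sqrt (qre (q * qconj q)).

Lemma qre_mul_conj q :
  qre (q * qconj q) = qre q ^+ 2 + qi q ^+ 2 + qj q ^+ 2 + qk q ^+ 2.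
Proof. by rewrite /=; ring. Qed.

Lemma qmul_conj q : q * qconj q = qreal (qre (q * qconj q)).
Proof. by congr Quat; rewrite /=; ring. Qed.

Lemma qconj_mul q : qconj q * q = qreal (qre (q * qconj q)).
Proof. by congr Quat; rewrite /=; ring. Qed.

Lemma qre_mul_conj_eq0 q : (qre (q * qconj q) == 0) = (q == 0).
Proof.
rewrite qre_mul_conj; apply/idP/eqP => [|->]; last first.
  by rewrite /= expr0n /= !addr0.
rewrite !paddr_eq0 ?addr_ge0 ?sqr_ge0// !sqrf_eq0.
by case: q => a b c d /= /andP[/andP[/andP[/eqP-> /eqP->] /eqP->] /eqP->].
Qed.

Definition qinv q := qreal (qre (q * qconj q))^-1 * qconj q.

Lemma qrealM a b : qreal a * qreal b = qreal (a * b).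
Proof. by congr Quat; rewrite /=; ring. Qed.

Lemma qrealC a q : qreal a * q = q * qreal a.
Proof. by congr Quat; rewrite /=; ring. Qed.

Lemma qmulV : {in [pred q : quat R | q != 0], left_inverse 1 qinv *%R}.
Proof.
move=> q; rewrite inE -qre_mul_conj_eq0 => q0.
by rewrite /qinv -mulrA qconj_mul qrealM mulVf.
Qed.

Lemma qdivv : {in [pred q : quat R | q != 0], right_inverse 1 qinv *%R}.
Proof.
move=> q; rewrite inE -qre_mul_conj_eq0 => q0.
by rewrite /qinv qrealC mulrA qmul_conj qrealM mulfV.
Qed.

Lemma qunitP p q : q * p = 1 /\ p * q = 1 -> p != 0.
Proof.
by move=> [+ _]; apply: contra_eq_neq => ->; rewrite mulr0 eq_sym oner_eq0.
Qed.

Lemma qinv_out : {in [predC [pred q : quat R | q != 0]], qinv =1 id}.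
Proof.
move=> q; rewrite !inE negbK => /eqP ->.
by congr Quat; rewrite /=; ring.
Qed.

HB.instance Definition _ :=
  GRing.NzRing_hasMulInverse.Build (quat R) qmulV qdivv qunitP qinv_out.

End QuatRing.

(* A right quaternionic Hilbert space is carried by its underlying real Banach
   space: [rscale_real] says that the real structure is the restriction of
   scalars of the right H-module structure, and [qnormE] that the norm, hence
   the topology, is the one induced by the inner product.  (An lmodType over
   the converse ring of H would conflict with the real lmodType.)  The inner
   product is right linear in its second argument; <x, x> is real by
   conjugate symmetry. *)
HB.mixin Record isQuatHilbert (R : realType) V & CompleteNormedModule R V := {
  rscale : V -> quat R -> V;
  rscaleDl : forall x y a, rscale (x + y) a = rscale x a + rscale y a;
  rscaleDr : forall x a b, rscale x (a + b) = rscale x a + rscale x b;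
  rscaleA : forall x a b, rscale x (a * b) = rscale (rscale x a) b;
  rscale1 : forall x, rscale x 1 = x;
  rscale_real : forall x (a : R), rscale x (qreal a) = a *: x;
  qdot : V -> V -> quat R;
  qdot_conj : forall x y, qdot y x = qconj (qdot x y);
  qdot_linear : forall x y z a b,
    qdot x (rscale y a + rscale z b) = qdot x y * a + qdot x z * b;
  qdot_gt0 : forall x, x != 0 -> 0 < qre (qdot x x);
  qnormE : forall x, `|x| = Num.sqrt (qre (qdot x x));
}.

#[short(type="quatHilbertType")]
HB.structure Definition QuatHilbert (R : realType) :=
  {V of CompleteNormedModule R V & isQuatHilbert R V}.

Section Spectra.
Variables (R : realType) (H : quatHilbertType R).
Implicit Types (A T : H -> H) (l : quat R).

Definition right_linear T := forall u v a b,
  T (rscale u a + rscale v b) = rscale (T u) a + rscale (T v) b.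

Definition bounded_op A :=
  exists K : R, 0 <= K /\ forall x, `|A x| <= K * `|x|.

Definition bounded_right_linear : set (H -> H) :=
  [set T | right_linear T /\ bounded_op T].

Definition bounded_below A :=
  exists k : R, 0 < k /\ forall x, k * `|x| <= `|A x|.

Definition right_op T l : H -> H := fun x => rscale x l - T x.

Definition Delta T l : H -> H := fun x =>
  T (T x) - (2 * qre l) *: T x + (qabs l ^+ 2) *: x.

Definition sigma_p T : set (quat R) :=
  [set l | exists x, x != 0 /\ right_op T l x = 0].

Definition sigma_r T : set (quat R) :=
  [set l | ~ sigma_p T l /\ closure (range (right_op T l)) <> setT].

Definition sigma_c T : set (quat R) :=
  [set l | ~ (sigma_r T `|` sigma_p T) l /\ ~ bounded_below (right_op T l)].

Definition sigma_Sp T : set (quat R) :=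
  [set l | exists x, x != 0 /\ Delta T l x = 0].

Definition sigma_Sr T : set (quat R) :=
  [set l | ~ sigma_Sp T l /\ closure (range (Delta T l)) <> setT].

Definition sigma_Sc T : set (quat R) :=
  [set l | ~ (sigma_Sp T `|` sigma_Sr T) l /\ ~ bounded_below (Delta T l)].

End Spectra.

(* Main.v *)
(** The operators [T_l] and [T_(l^* )] commute and their product is [Delta_l(T)].
    Since [l] and [l^*] have the same real part and modulus, there is a nonzero
    quaternion [p] with [l^* p = p l]; right multiplication by [p] is a
    multiple of an isometric bijection and intertwines [T_l] with [T_(l^* )].
    Hence [T_l] is injective, has dense range or is bounded below iff
    [T_(l^* )] is, and therefore iff [Delta_l(T)] is. *)
Require Import Defs.
From HB Require Import structures.
From mathcomp Require Import all_boot all_order all_algebra.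
From mathcomp Require Import ring.
From mathcomp Require Import all_classical all_reals all_analysis.

Set Implicit Arguments.
Unset Strict Implicit.
Unset Printing Implicit Defensive.

Import Order.TTheory GRing.Theory Num.Theory.
Import numFieldNormedType.Exports.

Local Open Scope classical_set_scope.
Local Open Scope ring_scope.

Section Quaternions.
Variable R : realType.
Implicit Types p q : quat R.

Lemma qre_mul_conj_ge0 q : 0 <= qre (q * qconj q).
Proof. by rewrite qre_mul_conj !addr_ge0 ?sqr_ge0. Qed.

Lemma qabs_sqr q : qabs q ^+ 2 = qre (q * qconj q).
Proof. by rewrite sqr_sqrtr ?qre_mul_conj_ge0. Qed.

Lemma qabs_ge0 q : 0 <= qabs q.
Proof. exact: sqrtr_ge0. Qed.

Lemma qabs_gt0 q : (0 < qabs q) = (q != 0).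
Proof. by rewrite sqrtr_gt0 lt_def qre_mul_conj_eq0 qre_mul_conj_ge0 andbT. Qed.

Lemma qconjK : involutive (@qconj R).
Proof. by case=> a b c d; congr Quat; rewrite /=; ring. Qed.

Lemma qconjM p q : qconj (p * q) = qconj q * qconj p.
Proof. by congr Quat; rewrite /=; ring. Qed.

Lemma qaddconj q : q + qconj q = qreal (2 * qre q).
Proof. by congr Quat; rewrite /=; ring. Qed.

(** A purely imaginary [p] orthogonal to the imaginary part of [q] anticommutes with it, so [p]
    moves past [q] at the cost of conjugating [q]. *)
Lemma qconj_similar q : exists2 p, p != 0 & qconj q * p = p * q.
Proof.
(* If [b = c = 0], the imaginary part is a multiple of k and i serves as [p]; otherwise take
   [c i - b j], orthogonal to [b i + c j + d k]. *)
case: q => a b c d; have [/andP[/eqP-> /eqP->]|bc0] := boolP ((b == 0) && (c == 0)).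
  exists (Quat 0 1 0 0); first by apply/eqP => -[] /eqP; rewrite oner_eq0.
  by congr Quat; rewrite /=; ring.
exists (Quat 0 c (- b) 0); last by congr Quat; rewrite /=; ring.
apply: contra bc0 => /eqP[-> /eqP].
by rewrite oppr_eq0 eqxx andbT.
Qed.

End Quaternions.

Section Hilbert.
Variables (R : realType) (H : quatHilbertType R).
Implicit Types (x y : H) (p q l : quat R) (A B T : H -> H).

Lemma rscale0r x : rscale x 0 = 0.
Proof. by rewrite -[0]/(qreal 0) rscale_real scale0r. Qed.

Lemma rscale0l q : rscale (0 : H) q = 0.
Proof. by apply: (addrI (rscale 0 q)); rewrite -rscaleDl !addr0. Qed.

Lemma rscaleNl x q : rscale (- x) q = - rscale x q.
Proof. by apply: (addrI (rscale x q)); rewrite -rscaleDl !subrr rscale0l. Qed.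

Lemma rscaleBl x y q : rscale (x - y) q = rscale x q - rscale y q.
Proof. by rewrite rscaleDl rscaleNl. Qed.

Lemma rscaleVK p : p != 0 -> cancel (fun x : H => rscale x p^-1) (fun x => rscale x p).
Proof. by move=> p0 x; rewrite -rscaleA mulVr// rscale1. Qed.

Lemma qdot_self x : qdot x x = qreal (qre (qdot x x)).
Proof.
have := qdot_conj x x; case: (qdot x x) => a b c d [_ hb hc hd].
(* Conjugate symmetry equates each imaginary component of [qdot x x] with its opposite, written
   [0 - u] because [qconj] is a subtraction. *)
have h0 (u : R) : u = 0 - u -> u = 0.
  by move=> /eqP; rewrite sub0r -subr_eq0 opprK -mulr2n mulrn_eq0 => /eqP.
by congr Quat; apply: h0.
Qed.

Lemma qdot_rscale x y q : qdot x (rscale y q) = qdot x y * q.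
Proof. by have := qdot_linear x y y q 0; rewrite rscale0r mulr0 !addr0. Qed.

(** The inner product of [rscale x q] with itself is [qconj q * qdot x x * q], and the middle factor
    is real, hence central. *)
Lemma norm_rscale x q : `|rscale x q| = qabs q * `|x|.
Proof.
rewrite !qnormE qdot_rscale (qdot_conj x) qdot_rscale qconjM qdot_self.
have -> : qre (qconj q * qconj (qreal (qre (qdot x x))) * q)
    = qre (q * qconj q) * qre (qdot x x) by rewrite /=; ring.
by rewrite sqrtrM ?qre_mul_conj_ge0.
Qed.

Lemma closure_rangeP A : closure (range A) = setT <->
  forall y (e : R), 0 < e -> exists x, `|y - A x| < e.
Proof.
split=> [cA y e e0|cA].
  have : closure (range A) y by rewrite cA.
  move=> /(_ _ (nbhsx_ballx y e e0)) [_ [[x _ <-]]].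
  by rewrite -ball_normE /= => ?; exists x.
apply/seteqP; split=> // y _ U /nbhs_ballP[e /= e0 yU].
have [x yx] := cA y e e0; exists (A x); split; first by exists x.
by apply: yU; rewrite -ball_normE.
Qed.

(** A strictly positive constant allows division by [K] below. *)
Lemma bounded_op_gt0 A : bounded_op A ->
  exists2 K : R, 0 < K & forall x, `|A x| <= K * `|x|.
Proof.
move=> [K [K0 AK]]; exists (K + 1); first by rewrite ltr_wpDl.
by move=> x; rewrite (le_trans (AK x))// ler_wpM2r// lerDl.
Qed.

Lemma closure_range_comp A B : (forall x y, A (x - y) = A x - A y) ->
    bounded_op A -> closure (range A) = setT -> closure (range B) = setT ->
  closure (range (A \o B)) = setT.
Proof.
move=> AB /bounded_op_gt0[K K0 AK] /closure_rangeP cA /closure_rangeP cB.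
apply/closure_rangeP => y e e0.
have e20 : 0 < e / 2 by rewrite divr_gt0.
have [x yx] := cA y _ e20.
(* [A] magnifies errors by at most [K], so this tolerance leaves the other half of [e] after
   applying [A]. *)
have [z xz] := cB x (e / 2 / K) (divr_gt0 e20 K0).
exists z; rewrite -(subrKA (A x)) (le_lt_trans (ler_normD _ _))//.
rewrite (splitr e) ltrD// -AB (le_lt_trans (AK _))//.
by rewrite mulrC -ltr_pdivlMr.
Qed.

Lemma bounded_below_comp A B :
  bounded_below A -> bounded_below B -> bounded_below (A \o B).
Proof.
move=> [a [a0 hA]] [b [b0 hB]]; exists (a * b); split; first exact: mulr_gt0.
by move=> x; rewrite (le_trans _ (hA _))// -mulrA ler_pM2l.
Qed.

(** This follows from [k |x| <= |A (B x)| <= K |B x|]. *)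
Lemma bounded_below_compr A B :
  bounded_op A -> bounded_below (A \o B) -> bounded_below B.
Proof.
move=> /bounded_op_gt0[K K0 AK] [k [k0 hk]].
exists (k / K); split; first exact: divr_gt0.
by move=> x; rewrite mulrAC ler_pdivrMr// [leRHS]mulrC (le_trans (hk x))/=.
Qed.

Section Operator.
Variables (T : H -> H) (hT : bounded_right_linear T).

Lemma right_linear_rscale x q : T (rscale x q) = rscale (T x) q.
Proof. by have := hT.1 x x q 0; rewrite !rscale0r !addr0. Qed.

Lemma right_linearB x y : T (x - y) = T x - T y.
Proof.
have := hT.1 x y 1 (qreal (- 1)).
by rewrite !rscale1 !rscale_real !scaleN1r.
Qed.

Lemma right_opB l x y : right_op T l (x - y) = right_op T l x - right_op T l y.
Proof. by rewrite /right_op rscaleBl right_linearB !opprD !opprK addrACA. Qed.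

Lemma right_op_bounded l : bounded_op (right_op T l).
Proof.
have [K [K0 TK]] := hT.2; exists (qabs l + K).
split=> [|x]; first by rewrite addr_ge0// qabs_ge0.
by rewrite (le_trans (ler_normB _ _))// mulrDl norm_rscale lerD2l.
Qed.

(** Right linearity turns [T (rscale x l)] into [rscale (T x) l], so the cross terms add up to [T x]
    times [l + qconj l], which is real. *)
Lemma right_op_conjE l : right_op T (qconj l) \o right_op T l = Delta T l.
Proof.
apply/funext => x; rewrite /= /right_op /Delta right_linearB right_linear_rscale.
rewrite rscaleBl -rscaleA qmul_conj -qabs_sqr -!rscale_real -qaddconj rscaleDr.
rewrite opprB [RHS]addrC -[LHS]addrA; congr (_ + _).
by rewrite addrCA opprD [in RHS](addrC (- _)).
Qed.

Lemma right_op_similar l p : qconj l * p = p * l ->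
  forall x, right_op T l (rscale x p) = rscale (right_op T (qconj l) x) p.
Proof.
by move=> lp x; rewrite /right_op right_linear_rscale rscaleBl -!rscaleA lp.
Qed.

Lemma sigma_p_conj l : sigma_p T (qconj l) -> sigma_p T l.
Proof.
have [p p0 lp] := qconj_similar l => -[x [x0 Tx]].
exists (rscale x p); rewrite (right_op_similar lp) Tx rscale0l; split=> //.
by rewrite -normr_gt0 norm_rscale mulr_gt0 ?qabs_gt0 ?normr_gt0.
Qed.

Lemma closure_range_conj l : closure (range (right_op T l)) = setT ->
  closure (range (right_op T (qconj l))) = setT.
Proof.
have [p p0 lp] := qconj_similar l => /closure_rangeP cT.
apply/closure_rangeP => y e e0.
(* Approximate [rscale y p] instead of [y]; cancelling [p] afterwards divides the error by
   [qabs p]. *)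
have [x yx] := cT (rscale y p) _ (mulr_gt0 e0 (etrans (qabs_gt0 p) p0)).
exists (rscale x p^-1); rewrite -(ltr_pM2r (etrans (qabs_gt0 p) p0)).
by rewrite mulrC -norm_rscale rscaleBl -(right_op_similar lp) rscaleVK.
Qed.

Lemma bounded_below_conj l : bounded_below (right_op T l) ->
  bounded_below (right_op T (qconj l)).
Proof.
have [p p0 lp] := qconj_similar l => -[k [k0 hk]].
(* The same [k] works: at [rscale x p], both sides of the bound for [T_l] carry the factor
   [qabs p]. *)
exists k; split=> // x; rewrite -(ler_pM2l (etrans (qabs_gt0 p) p0)).
by rewrite mulrCA -!norm_rscale -(right_op_similar lp).
Qed.

Lemma sigma_p_Sp : sigma_p T = sigma_Sp T.
Proof.
apply/seteqP; split=> l [x [x0]]; last first.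
  (* Either [x] is already an eigenvector for [l], or its nonzero image under [T_l] is one for
     [qconj l]. *)
  rewrite -right_op_conjE /= => Tx; have [?|y0] := eqVneq (right_op T l x) 0.
    by exists x.
  by apply: sigma_p_conj; exists (right_op T l x).
move=> Tx; exists x; split=> //; rewrite -right_op_conjE /= Tx.
by have := right_opB (qconj l) 0 0; rewrite !subrr.
Qed.

Lemma closure_range_Delta l :
  closure (range (Delta T l)) = setT <-> closure (range (right_op T l)) = setT.
Proof.
split=> [|cT]; last first.
  rewrite -right_op_conjE; apply: closure_range_comp (closure_range_conj cT) cT.
    exact: right_opB.
  exact: right_op_bounded.
(* The range of [Delta T l] lies in that of the outer factor, so density is obtained for [qconj l]
   and then carried over to [l]. *)
rewrite -right_op_conjE => cD; rewrite -[l]qconjK; apply: closure_range_conj.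
apply/seteqP; split=> // y _.
have : closure (range (right_op T (qconj l) \o right_op T l)) y by rewrite cD.
by apply: closureS => _ [x _ <-]; exists (right_op T l x).
Qed.

(** Forwards, the inner factor [T_l] inherits the lower bound because the outer one is bounded;
    backwards, lower bounds multiply. *)
Lemma bounded_below_Delta l :
  bounded_below (Delta T l) <-> bounded_below (right_op T l).
Proof.
rewrite -right_op_conjE; split=> [|bT].
  exact/bounded_below_compr/right_op_bounded.
exact/bounded_below_comp/bT/bounded_below_conj.
Qed.

Lemma sigma_r_Sr : sigma_r T = sigma_Sr T.
Proof.
rewrite /sigma_r /sigma_Sr sigma_p_Sp.
by apply/funext => l /=; rewrite (propext (closure_range_Delta l)).
Qed.

Lemma sigma_c_Sc : sigma_c T = sigma_Sc T.
Proof.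
(* The two definitions list the excluded point and residual parts in opposite orders, hence
   [setUC]. *)
rewrite /sigma_c /sigma_Sc sigma_p_Sp sigma_r_Sr setUC.
by apply/funext => l /=; rewrite (propext (bounded_below_Delta l)).
Qed.

End Operator.
End Hilbert.

Theorem theorem4 (R : realType) (H : quatHilbertType R) (T : H -> H)
    (hT : bounded_right_linear T) :
  sigma_p T = sigma_Sp T /\ sigma_r T = sigma_Sr T /\ sigma_c T = sigma_Sc T.
Proof.
by rewrite sigma_p_Sp// sigma_r_Sr// sigma_c_Sc.
Qed.
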